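(* Let $\mathbb{K}$ be any field and let $\Omega$ be any Sturmian word, written in the alphabet $\{x,y\}$. Then the contracted semigroup algebra $\mathbb{K}_0S(\Omega)$ is a non-nil algebra which is the sum of the two locally nilpotent subalgebras $\mathbb{K}_0S(\Omega)_+$ and $\mathbb{K}_0S(\Omega)_-$.
   Context: A Sturmian word is a (one-sided) infinite word having exactly $n+1$ different subwords (finite factors, i.e. blocks of consecutive letters) of length $n$ for every $n\ge1$; in particular it uses exactly two letters, here $x$ and $y$. For a finite nonempty word $w$ in $x,y$, $|w|$ is its length, $\partial_x(w)$ and $\partial_y(w)$ are the numbers of occurrences of $x$ and $y$ in $w$, and $\pi(w)=\partial_x(w)/|w|$. The slope of $\Omega$ is $\alpha=\lim_{n\to\infty}\pi(u_n)$, where $u_n$ runs over the nonempty initial subwords of $\Omega$ (for a Sturmian word the limit exists and is an irrational number in $(0,1)$). Let $\langle x,y\rangle$ be the free nonunitary semigroup (nonempty finite words). $S(\Omega)$ is the Rees factor semigroup $\langle x,y\rangle/\mathbb{I}$, i.e. $(\langle x,y\rangle\setminus\mathbb{I})\cup\{0\}$ with all elements of $\mathbb{I}$ identified with $0$, where $\mathbb{I}$ is the ideal of all words that are not subwords of $\Omega$. On nonzero $u\in S(\Omega)$ put $d(u)=(1-\alpha)\partial_x(u)-\alpha\,\partial_y(u)$, and let $S(\Omega)_+=\{s\in S(\Omega)\setminus\{0\}\mid d(s)>0\}\cup\{0\}$ and $S(\Omega)_-=\{s\in S(\Omega)\setminus\{0\}\mid d(s)<0\}\cup\{0\}$. For a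 semigroup $T$ with zero, $\mathbb{K}_0T$ is the contracted semigroup algebra: the associative $\mathbb{K}$-algebra with vector space basis $T\setminus\{0\}$ and multiplication induced by that of $T$ (with the zero of $T$ identified with $0$). An algebra is nil if each of its elements is nilpotent; it is locally nilpotent if every finitely generated subalgebra is nilpotent. *)

(* Defs.v *)
From HB Require Import structures.
From mathcomp Require Import all_boot all_order all_algebra finmap.
From mathcomp.multinomials Require Import monalg.
From mathcomp Require Import boolp classical_sets reals topology normedtype.
From mathcomp Require Import sequences.

Set Implicit Arguments.
Unset Strict Implicit.
Unset Printing Implicit Defensive.

Import Order.TTheory GRing.Theory Num.Theory.
Import numFieldNormedType.Exports.

Local Open Scope classical_set_scope.
Local Open Scope ring_scope.

(* Associative algebras that need not have a unit; the ring structures of     *)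
(* MathComp are all unital.                                                   *)
HB.mixin Record Lmodule_isNUAlgebra (K : comNzRingType) A
    of GRing.Lmodule K A := {
  numul : A -> A -> A;
  numulA : associative numul;
  numulDl : left_distributive numul +%R;
  numulDr : right_distributive numul +%R;
  numulZl : forall (c : K) x y, numul (c *: x) y = c *: numul x y;
  numulZr : forall (c : K) x y, numul x (c *: y) = c *: numul x y
}.

#[short(type="nuAlgType")]
HB.structure Definition NUAlgebra (K : comNzRingType) :=
  {A of GRing.Lmodule K A & Lmodule_isNUAlgebra K A}.

Declare Scope nualg_scope.
Delimit Scope nualg_scope with nualg.
Notation "x ** y" := (numul x y) (at level 40, left associativity)
  : nualg_scope.
Local Open Scope nualg_scope.

Section NUAlgebraNotions.
Context {K : comNzRingType} {A : nuAlgType K}.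

(* [iter n (numul x) x] is the power of [x] with exponent [n.+1]. *)
Definition nilpotent_elt (x : A) := exists n, iter n (numul x) x = 0.

Definition subalgebra (B : set A) :=
  [/\ B 0,
      forall x y, B x -> B y -> B (x + y),
      forall c x, B x -> B (c *: x) &
      forall x y, B x -> B y -> B (x ** y)].

Definition generated_subalgebra (X : set A) : set A := smallest subalgebra X.

(* Some positive power of [B] vanishes: all products of [n.+1] elements of    *)
(* [B], namely [x] followed by the [n] elements of [s], are zero.             *)
Definition nilpotent_subalgebra (B : set A) :=
  exists n, forall (x : A) (s : seq A),
    B x -> [set` s] `<=` B -> size s = n -> foldl numul x s = 0.

Definition locally_nilpotent (B : set A) :=
  forall s : seq A, [set` s] `<=` B ->
    nilpotent_subalgebra (generated_subalgebra [set` s]).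

End NUAlgebraNotions.

Definition nil_algebra (K : comNzRingType) (A : nuAlgType K) :=
  forall x : A, nilpotent_elt x.

HB.mixin Record Semigroup_hasZero T of Semigroup T := {
  sg0 : T;
  mul0sg : left_zero sg0 ( *%g : T -> T -> T);
  mulsg0 : right_zero sg0 ( *%g : T -> T -> T)
}.

#[short(type="semigroup0Type")]
HB.structure Definition Semigroup0 := {T of Semigroup T & Semigroup_hasZero T}.

Section ContractedAlgebra.
Context (K : comNzRingType) (T : semigroup0Type).

Definition nonzero := {t : T | t != sg0}.

Definition contracted := {malg K[nonzero]}.

HB.instance Definition _ := GRing.Lmodule.on contracted.

(* The zero of [T] is sent to the zero of the algebra. *)
Definition cbasis (t : T) : contracted :=
  if insub t is Some b then << (b : nonzero) >> else 0.

Definition cmul (f g : contracted) : contracted :=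
  \sum_(s <- msupp f) \sum_(t <- msupp g)
    (f@_s * g@_t) *: cbasis (val s * val t)%g.

Lemma cmulw (d e : {fset nonzero}) (f g : contracted) :
  (msupp f `<=` d)%fset -> (msupp g `<=` e)%fset ->
  cmul f g = \sum_(s <- d) \sum_(t <- e)
    (f@_s * g@_t) *: cbasis (val s * val t)%g.
Proof.
move=> fd ge; rewrite /cmul (big_fset_incl _ fd) /=.
  apply/eq_bigr=> s _; apply/big_fset_incl => // t _ /mcoeff_outdom ->.
  by rewrite mulr0 scale0r.
move=> s _ /mcoeff_outdom fs.
by rewrite big1 // => t _; rewrite fs mul0r scale0r.
Qed.

Lemma cmulDl : left_distributive cmul +%R.
Proof.
move=> f g h.
rewrite (cmulw (msuppD_le f g) (fsubset_refl _)).
rewrite (cmulw (fsubsetUl (msupp f) (msupp g)) (fsubset_refl _)).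
rewrite (cmulw (fsubsetUr (msupp f) (msupp g)) (fsubset_refl _)).
rewrite -big_split /=; apply/eq_bigr=> s _.
rewrite -big_split /=; apply/eq_bigr=> t _.
by rewrite mcoeffD mulrDl scalerDl.
Qed.

Lemma cmulDr : right_distributive cmul +%R.
Proof.
move=> h f g.
rewrite (cmulw (fsubset_refl _) (msuppD_le f g)).
rewrite (cmulw (fsubset_refl _) (fsubsetUl (msupp f) (msupp g))).
rewrite (cmulw (fsubset_refl _) (fsubsetUr (msupp f) (msupp g))).
rewrite -big_split /=; apply/eq_bigr=> s _.
rewrite -big_split /=; apply/eq_bigr=> t _.
by rewrite mcoeffD mulrDr scalerDl.
Qed.

Lemma cmulZl (c : K) (f g : contracted) : cmul (c *: f) g = c *: cmul f g.
Proof.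
rewrite (cmulw (msuppZ_le c f) (fsubset_refl _)) scaler_sumr.
apply/eq_bigr=> s _; rewrite scaler_sumr; apply/eq_bigr=> t _.
by rewrite mcoeffZ scalerA mulrA.
Qed.

Lemma cmulZr (c : K) (f g : contracted) : cmul f (c *: g) = c *: cmul f g.
Proof.
rewrite (cmulw (fsubset_refl _) (msuppZ_le c g)) scaler_sumr.
apply/eq_bigr=> s _; rewrite scaler_sumr; apply/eq_bigr=> t _.
by rewrite mcoeffZ scalerA mulrCA.
Qed.

Lemma cmul0r (f : contracted) : cmul 0 f = 0.
Proof. by have := cmulZl 0 0 f; rewrite !scale0r. Qed.

Lemma cmulr0 (f : contracted) : cmul f 0 = 0.
Proof. by have := cmulZr 0 f 0; rewrite !scale0r. Qed.

Lemma cbasis0 : cbasis sg0 = 0.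
Proof. by rewrite /cbasis insubF // eqxx. Qed.

Lemma cbasisE (s : nonzero) : cbasis (val s) = << s >>.
Proof. by rewrite /cbasis valK. Qed.

Lemma cmul_basis (s t : T) : cmul (cbasis s) (cbasis t) = cbasis (s * t)%g.
Proof.
have [->|s0] := eqVneq s sg0; first by rewrite cbasis0 cmul0r mul0sg cbasis0.
have [->|t0] := eqVneq t sg0; first by rewrite cbasis0 cmulr0 mulsg0 cbasis0.
pose a : nonzero := exist _ s s0; pose b : nonzero := exist _ t t0.
rewrite -[s]/(val a) -[t]/(val b).
rewrite !cbasisE (cmulw msuppU_le msuppU_le) !big_seq_fset1 !mcoeffUU.
by rewrite mulr1 scale1r.
Qed.

Lemma cbasis_sum (f : contracted) :
  f = \sum_(s <- msupp f) f@_s *: cbasis (val s).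
Proof.
rewrite {1}[f]monalgE; apply/eq_bigr=> s _; rewrite cbasisE.
by apply/malgP=> k; rewrite mcoeffZ !mcoeffU mulrnAr mulr1.
Qed.

Lemma cmul_suml (I : Type) (r : seq I) (F : I -> contracted) (g : contracted) :
  cmul (\sum_(i <- r) F i) g = \sum_(i <- r) cmul (F i) g.
Proof. exact: (big_morph (cmul^~ g) (fun _ _ => cmulDl _ _ _) (cmul0r g)). Qed.

Lemma cmul_sumr (I : Type) (r : seq I) (F : I -> contracted) (g : contracted) :
  cmul g (\sum_(i <- r) F i) = \sum_(i <- r) cmul g (F i).
Proof. exact: (big_morph (cmul g) (fun _ _ => cmulDr _ _ _) (cmulr0 g)). Qed.

Lemma cmulA : associative cmul.
Proof.
move=> f g h; rewrite [f]cbasis_sum (cmul_suml _ _ (cmul g h)).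
rewrite (cmul_suml _ _ g) (cmul_suml _ _ h); apply/eq_bigr=> s _.
rewrite !cmulZl; congr (_ *: _).
rewrite [g]cbasis_sum (cmul_suml _ _ h) !(cmul_sumr _ _ (cbasis _)).
rewrite (cmul_suml _ _ h); apply/eq_bigr=> t _.
rewrite !(cmulZl, cmulZr); congr (_ *: _).
rewrite [h]cbasis_sum (cmul_sumr _ _ (cbasis (val t))).
rewrite (cmul_sumr _ _ (cbasis (val s))) (cmul_sumr _ _ (cmul _ _)).
apply/eq_bigr=> u _.
by rewrite !cmulZr !cmul_basis mulgA.
Qed.

HB.instance Definition _ :=
  Lmodule_isNUAlgebra.Build K contracted cmulA cmulDl cmulDr cmulZl cmulZr.

(* The subspace spanned by the nonzero elements of [U], which is the          *)
(* contracted algebra of [U] when [U] is a subsemigroup containing zero.      *)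
Definition contracted_sub (U : set T) : set contracted :=
  [set f | forall t : nonzero, t \in msupp f -> U (val t)].

End ContractedAlgebra.

(* Two-sided ideals; the empty one is allowed. *)
Record ideal (S : semigroupType) := Ideal {
  ideal_pred :> pred S;
  idealMl : forall s t, ideal_pred t -> ideal_pred (s * t)%g;
  idealMr : forall s t, ideal_pred s -> ideal_pred (s * t)%g
}.

Section ReesFactor.
Context (S : semigroupType) (I : ideal S).

(* [None] is the class of [I]. *)
Definition rees := option {s : S | ~~ I s}.

HB.instance Definition _ := Choice.on rees.

Definition rees_class (s : S) : rees := insub s.

Definition rees_mul (a b : rees) : rees :=
  if a is Some s then
    if b is Some t then rees_class (val s * val t)%g else None
  else None.

Lemma rees_class_mul (s t : S) :
  rees_mul (rees_class s) (rees_class t) = rees_class (s * t)%g.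
Proof.
rewrite /rees_class; case: insubP => [a _ <-|/negPn Is] /=; last first.
  by rewrite insubF // idealMr.
case: insubP => [b _ <-|/negPn It] //=.
by rewrite insubF // idealMl.
Qed.

Lemma rees_classK (a : rees) : a = None \/ exists s, a = rees_class s.
Proof.
by case: a => [s|]; [right; exists (val s); rewrite /rees_class valK | left].
Qed.

Lemma rees_mul0 : right_zero (None : rees) rees_mul.
Proof. by case. Qed.

Lemma rees_mulA : associative rees_mul.
Proof.
move=> a b c.
have [->|[s ->]] := rees_classK a; first by [].
have [->|[t ->]] := rees_classK b; first by rewrite !rees_mul0.
have [->|[u ->]] := rees_classK c; first by rewrite !rees_mul0.
by rewrite !rees_class_mul mulgA.
Qed.

HB.instance Definition _ := isSemigroup.Build rees rees_mulA.
HB.instance Definition _ :=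
  Semigroup_hasZero.Build rees (fun _ => erefl) rees_mul0.

End ReesFactor.

Section FreeSemigroup.
Context (X : choiceType).

Definition free_semigroup := {w : seq X | w != [::]}.

HB.instance Definition _ := Choice.on free_semigroup.

Lemma free_mul_subproof (u v : free_semigroup) : val u ++ val v != [::].
Proof. by case: u => -[]. Qed.

Definition free_mul (u v : free_semigroup) : free_semigroup :=
  exist _ (val u ++ val v) (free_mul_subproof u v).

Lemma free_mulA : associative free_mul.
Proof. by move=> u v w; apply/val_inj; rewrite /= catA. Qed.

HB.instance Definition _ := isSemigroup.Build free_semigroup free_mulA.

End FreeSemigroup.

Variant letter := lx | ly.

Definition letter_to_bool l := if l is lx then true else false.
Definition bool_to_letter (b : bool) := if b then lx else ly.
Lemma letter_to_boolK : cancel letter_to_bool bool_to_letter.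
Proof. by case. Qed.

HB.instance Definition _ := Finite.copy letter (can_type letter_to_boolK).

Definition word := free_semigroup letter.

HB.instance Definition _ := Semigroup.on word.

Section InfiniteWords.
Context (Omega : nat -> letter).

Definition block (i n : nat) : seq letter := [seq Omega j | j <- iota i n].

Definition subword (w : seq letter) := exists i, w = block i (size w).

Definition sturmian :=
  forall n, (1 <= n)%N -> #|[pred w : n.-tuple letter | `[< subword w >]]| = n.+1.

Lemma initial_subproof n : block 0 n.+1 != [::].
Proof. by []. Qed.

(* The initial subword of length [n.+1]. *)
Definition initial n : word := exist _ (block 0 n.+1) (initial_subproof n).

Lemma subword_catl (u v : seq letter) : subword (u ++ v) -> subword u.
Proof.
case=> i; rewrite /block size_cat iotaD map_cat => /eqP.
by rewrite eqseq_cat ?size_map ?size_iota // => /andP[/eqP uE _]; exists i.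
Qed.

Lemma subword_catr (u v : seq letter) : subword (u ++ v) -> subword v.
Proof.
case=> i; rewrite /block size_cat iotaD map_cat => /eqP.
rewrite eqseq_cat ?size_map ?size_iota // => /andP[_ /eqP vE].
by exists (i + size u)%N.
Qed.

Definition non_subword : pred word := fun w => `[< ~ subword (val w) >].

Lemma non_subwordMl s t : non_subword t -> non_subword (s * t)%g.
Proof. by move=> /asboolP tN; apply/asboolP => /subword_catr. Qed.

Lemma non_subwordMr s t : non_subword s -> non_subword (s * t)%g.
Proof. by move=> /asboolP sN; apply/asboolP => /subword_catl. Qed.

Definition non_subword_ideal : ideal word := Ideal non_subwordMl non_subwordMr.

Definition subword_semigroup := rees non_subword_ideal.

HB.instance Definition _ := Semigroup0.on subword_semigroup.

Context (R : realType).

Definition occ (l : letter) (w : word) : R := (count_mem l (val w))%:R.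

Definition frequency (w : word) : R := occ lx w / (size (val w))%:R.

(* [lim] is total; for a Sturmian word the frequencies do converge. *)
Definition slope : R := lim ((fun n => frequency (initial n)) @ \oo).

Definition degree (w : word) : R :=
  (1 - slope) * occ lx w - slope * occ ly w.

Definition positive_part : set subword_semigroup :=
  [set s | if s is Some u then 0 < degree (val u) else True].

Definition negative_part : set subword_semigroup :=
  [set s | if s is Some u then degree (val u) < 0 else True].

End InfiniteWords.

Arguments positive_part Omega R : clear implicits.
Arguments negative_part Omega R : clear implicits.

(* Main.v *)
(* Morse and Hedlund: a Sturmian word is balanced, that is, two factors of    *)
(* the same length differ by at most one in their numbers of letters x. Hence *)
(* the degree d is bounded on factors of Omega; it never vanishes there,      *)
(* because a rational slope would force Omega to be eventually periodic. The  *)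
(* second fact splits the algebra into its positive and negative parts. For   *)
(* the first, finitely many elements of positive degree have all their        *)
(* degrees at least e > 0, so long products of them have degrees exceeding    *)
(* the bound and vanish; the negative part is symmetric. Finally, (x + y)^n   *)
(* is the sum of all factors of length n, which is not zero.                  *)

Require Import Defs.
From mathcomp Require Import all_boot all_order all_algebra finmap zify.
From mathcomp.multinomials Require Import monalg.
From mathcomp Require Import boolp classical_sets reals topology normedtype.
From mathcomp Require Import sequences lra.

Set Implicit Arguments.
Unset Strict Implicit.
Unset Printing Implicit Defensive.

Import Order.TTheory GRing.Theory Num.Theory.
Import numFieldNormedType.Exports.

(** Balance is [sturmian_balanced]: a minimal unbalanced pair would force a right special factor
    whose uniqueness ([card_right_special]) makes Omega eventually periodic, against
    [sturmian_aperiodic]. It yields [degree_bounded] and, again with aperiodicity, [degree_neq0].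
    Local nilpotency, [degree_pos_locally_nilpotent], holds for any additive degree bounded above
    off the ideal, and is applied to d and -d. *)

Section Combinatorics.
Variable Omega : nat -> letter.
Local Notation block := (block Omega).
Local Notation subword := (subword Omega).

(** * Factor complexity and right special factors *)

Lemma size_block i n : size (block i n) = n.
Proof. by rewrite size_map size_iota. Qed.

Lemma block_cat i m n : block i (m + n) = block i m ++ block (i + m) n.
Proof. by rewrite /Defs.block iotaD map_cat. Qed.

Lemma nth_block l i n k : k < n -> nth l (block i n) k = Omega (i + k).
Proof. by move=> kn; rewrite (nth_map 0) ?size_iota // nth_iota. Qed.

Lemma eq_blockP i j n :
  block i n = block j n <-> (forall k, k < n -> Omega (i + k) = Omega (j + k)).
Proof.
split=> [e k kn|e]; first by rewrite -(nth_block lx i kn) e nth_block.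
apply: (@eq_from_nth _ lx); rewrite !size_block // => k kn.
by rewrite !nth_block // e.
Qed.

Lemma block_rcons i n : block i n.+1 = rcons (block i n) (Omega (i + n)).
Proof. by rewrite -addn1 block_cat -cats1. Qed.

Lemma subword_block i n : subword (block i n).
Proof. by exists i; rewrite size_block. Qed.

Definition block_tuple i n : n.-tuple letter :=
  Tuple (introT eqP (size_block i n)).

Lemma subwordP n (w : n.-tuple letter) :
  subword w -> exists i, w = block_tuple i n.
Proof.
by case=> i wE; exists i; apply/val_inj; rewrite /= {1}wE size_tuple.
Qed.

Hypothesis sturm : sturmian Omega.

(** Shifting back by q, every block of length N + q also starts before N + q, so there are at most N
    + q of them, one too few. *)
Lemma sturmian_aperiodic N q :
  0 < q -> ~ (forall i, N <= i -> Omega (i + q) = Omega i).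
Proof.
move=> q0 per; pose n := N + q.
have red i : exists2 r, r < n & block i n = block r n.
  elim/ltn_ind: i => i IH; have [lt_in|le_ni] := ltnP i n; first by exists i.
  have [|r lt_rn e] := IH (i - q); first by lia.
  exists r => //; rewrite -e; apply/eq_blockP => k _.
  by rewrite -[in RHS]per; [congr Omega | ]; lia.
have : #|[pred w : n.-tuple letter | `[< subword w >]]| <= n.
  rewrite -[X in _ <= X]card_ord.
  apply: leq_trans (leq_image_card (fun r : 'I_n => block_tuple r n) predT).
  apply: subset_leq_card; apply/fintype.subsetP => w /asboolP /subwordP [i ->].
  have [r lt_rn e] := red i; apply/fintype.imageP; exists (Ordinal lt_rn) => //.
  by apply/val_inj.
by rewrite sturm ?ltnn // /n; lia.
Qed.

Definition right_special n : {set n.-tuple letter} :=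
  [set u : n.-tuple letter | `[< subword (rcons u lx) >] &&
    `[< subword (rcons u ly) >]].

(** Each of the n + 1 factors of length n extends to the right in one or two ways, giving n + 2
    factors in all; so exactly one extends in two ways. *)
Lemma card_right_special n : 0 < n -> #|right_special n| = 1.
Proof.
move=> n0.
pose E l := [set u : n.-tuple letter | `[< subword (rcons u l) >]].
have EU : E lx :|: E ly = [set w : n.-tuple letter | `[< subword w >]].
  apply/setP => u; rewrite !inE; apply/idP/idP.
    by case/orP=> /asboolP; rewrite -cats1 => /subword_catl /asboolP.
  move/asboolP/subwordP => [i ->] /=.
  have := subword_block i n.+1; rewrite block_rcons.
  by case: (Omega (i + n)) => /asboolP ->; rewrite ?orbT.
have EI : E lx :&: E ly = right_special n.
  by apply/setP => u; rewrite !inE.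
pose F l := [set rcons_tuple u l | u in E l].
have cF l : #|F l| = #|E l|.
  apply: card_imset => u v /(congr1 val) /= /rcons_inj [e].
  exact: val_inj.
have FU : F lx :|: F ly = [set w : n.+1.-tuple letter | `[< subword w >]].
  apply/setP => w; rewrite !inE; apply/idP/idP.
    by case/orP=> /imsetP[u]; rewrite inE => ? ->.
  move/asboolP/subwordP => [i ->].
  have H : block_tuple i n.+1 \in F (Omega (i + n)).
    apply/imsetP; exists (block_tuple i n).
      by rewrite inE; apply/asboolP; rewrite /= -block_rcons;
        apply: subword_block.
    by apply/val_inj; rewrite /= -block_rcons.
  by move: H; case: (Omega (i + n)) => ->; rewrite ?orbT.
have FI : F lx :&: F ly = finset.set0.
  apply/setP => w; rewrite !inE; apply/negbTE/negP => /andP[].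
  move=> /imsetP[u _ ->] /imsetP[v _] /(congr1 val) /= /rcons_inj [] //.
have := cardsUI (E lx) (E ly); have := cardsUI (F lx) (F ly).
by rewrite FU FI EU EI !cF cards0 !cardsE !sturm //; lia.
Qed.

(* Let [w] be the palindrome following position [j], so that [b w b] occurs   *)
(* at [j]. Since [w] is a palindrome and a <> b, the word [a w] is none of    *)
(* the [n.+2] blocks of length [n.+1] starting in [b w b]. If [a w] were the  *)
(* only right special word of its length, two of these blocks would coincide  *)
(* and each would determine its successor, so Omega would be eventually       *)
(* periodic.                                                                  *)
Lemma right_special_neq_palindrome i j n (a b : letter) : a != b ->
  Omega i = a -> Omega j = b ->
  (forall k, 0 < k <= n -> Omega (i + k) = Omega (j + k)) ->
  Omega (j + n.+1) = b ->
  (forall k, 0 < k <= n -> Omega (j + k) = Omega (j + (n.+1 - k))) ->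
  right_special n.+1 != [set block_tuple i n.+1].
Proof.
move=> ab Oi Oj ij Oj' pal; apply/eqP => rs.
have avoid t : t <= n.+1 -> block (j + t) n.+1 != block i n.+1.
  move=> tn; apply/eqP => /eq_blockP e.
  have [t0|t0] := posnP t.
    by move: (e 0 isT); rewrite t0 !addn0 Oi Oj => /eqP;
      rewrite eq_sym (negbTE ab).
  have Ot : Omega (j + t) = a by have := e 0 isT; rewrite !addn0 Oi.
  have [tn1|tn1] := eqVneq t n.+1.
    by move: ab; rewrite -Ot tn1 Oj' eqxx.
  (* At this index the block starting at [j + t] has the closing b, while in [a w] the palindrome
     reflects the index to t, where the letter is a. *)
  have /e : n.+1 - t < n.+1 by lia.
  rewrite ij; last by lia.
  rewrite -pal; last by lia.
  rewrite Ot (_ : j + t + _ = j + n.+1); last by lia.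
  by rewrite Oj' => ba; move: ab; rewrite ba eqxx.
have det r s : block r n.+1 = block s n.+1 -> block r n.+1 != block i n.+1 ->
    block r.+1 n.+1 = block s.+1 n.+1.
  move=> e ne.
  suff eO : Omega (r + n.+1) = Omega (s + n.+1).
    have /(congr1 behead) // : block r n.+2 = block s n.+2.
    by rewrite !(block_rcons _ n.+1) e eO.
  apply: contrapT => neO; move: ne; apply/negP; rewrite negbK; apply/eqP.
  have : block_tuple r n.+1 \in right_special n.+1.
    rewrite inE /=.
    have := subword_block r n.+2; have := subword_block s n.+2.
    rewrite !(block_rcons _ n.+1) -e; move: neO.
    by case: (Omega (r + _)); case: (Omega (s + _)) => // _
      /asboolP -> /asboolP ->.
  by rewrite rs inE => /eqP /(congr1 val).
(* Pigeonhole: n + 2 starting positions, but only n + 1 factors other than [a w]. *)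
have /injectivePn [t [t' tt' ett']] :
    ~~ injectiveb (fun t : 'I_n.+2 => block_tuple (j + t) n.+1).
  apply/negP => /injectiveP inj.
  have := card_imset predT inj.
  have sub : [set block_tuple (j + t) n.+1 | t : 'I_n.+2] \subset
     [set w : n.+1.-tuple letter | `[< subword w >]] :\ block_tuple i n.+1.
    apply/fintype.subsetP => w /imsetP[t _ ->]; rewrite !inE; apply/andP; split.
      by apply: contra (avoid t (ltn_ord t)) => /eqP/(congr1 val)/= ->.
    exact/asboolP/subword_block.
  have := subset_leq_card sub.
  have := cardsD1 (block_tuple i n.+1)
    [set w : n.+1.-tuple letter | `[< subword w >]].
  rewrite inE asboolT; last exact: subword_block.
  rewrite cardsE sturm // card_ord => h1 h2 h3; rewrite h3 in h2; lia.
move/(congr1 val): ett' => /=.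
wlog lt_tt' : t t' tt' / (t < t')%N => [th e|e].
  by move: tt'; rewrite neq_ltn => /orP[] h;
    [apply: (th t t') | apply: (th t' t)];
    rewrite // neq_ltn h ?orbT.
apply: (@sturmian_aperiodic (j + t) (t' - t)); first by lia.
(* The second clause keeps the blocks among those starting in [t, t'), which avoid [a w], so that
   [det] applies forever. *)
have inv s : block (j + t + s) n.+1 = block (j + t' + s) n.+1 /\
    exists2 r, t <= r < t' & block (j + t + s) n.+1 = block (j + r) n.+1.
  elim: s => [|s [e1 [r rt e2]]].
    by rewrite !addn0; split=> //; exists t => //; lia.
  have ne : block (j + t + s) n.+1 != block i n.+1.
    by rewrite e2; apply: avoid; have := ltn_ord t'; lia.
  rewrite !addnS; split; first exact: det.
  have [rt'|rt'] := eqVneq r.+1 t'.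
    exists t; first by lia.
    by rewrite (det _ _ e2 ne) -addnS rt' e.
  exists r.+1; first by lia.
  by rewrite (det _ _ e2 ne) addnS.
move=> k le_k; have [/eq_blockP /(_ 0 isT)] := inv (k - (j + t)).
rewrite !addn0 => e' _;
rewrite (_ : k + _ = j + t' + (k - (j + t))); last by lia.
by rewrite -e'; congr Omega; lia.
Qed.

(** * Balance *)

Definition xcount i n := count_mem lx (block i n).

Lemma xcountD i m n : xcount i (m + n) = xcount i m + xcount (i + m) n.
Proof. by rewrite /xcount block_cat count_cat. Qed.

Lemma xcount1 i : xcount i 1 = (Omega i == lx).
Proof. by rewrite /xcount /= addn0. Qed.

Lemma xcount1_inj i j : xcount i 1 = xcount j 1 -> Omega i = Omega j.
Proof. by rewrite !xcount1; case: (Omega i); case: (Omega j). Qed.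

(* An unbalanced pair of minimal length [n.+2] is [x w x], [y w y] with [w] a *)
(* palindrome, and the right special word of length [n.+1] is [x w] or [y w]. *)
Lemma sturmian_balanced i j n : xcount i n <= (xcount j n).+1.
Proof.
elim/ltn_ind: n i j => m bal i j; rewrite leqNgt; apply/negP => unbal.
(* By minimality prefix and suffix each contribute at most 1 to an excess of at least 2. *)
have step k : 0 < k < m -> xcount i k = (xcount j k).+1.
  move=> km; have := bal k _ i j; have := bal (m - k) _ (i + k) (j + k).
  have e : m = k + (m - k) by lia.
  by move: unbal; rewrite {1 2}e !xcountD; lia.
have m2 : 1 < m.
  case: m unbal {bal step} => [|[|m]] //; rewrite ?xcount1 //.
  by case: (Omega i); case: (Omega j).
have [n mE] : exists n, m = n.+2 by exists m.-2; lia.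
subst m.
have e1 := step 1 isT.
have Oi : Omega i = lx by move: e1; rewrite !xcount1; case: (Omega i).
have Oj : Omega j = ly.
  by move: e1; rewrite !xcount1; case: (Omega j); case: (Omega i).
have Oij k : 0 < k <= n -> Omega (i + k) = Omega (j + k).
  move=> kn; apply: xcount1_inj.
  have := step k.+1; have := step k.
  by rewrite -(addn1 k) !xcountD; lia.
have last : xcount (i + n.+1) 1 = (xcount (j + n.+1) 1).+1.
  move: unbal; rewrite -(addn1 n.+1) !xcountD; have := step n.+1.
  have := bal 1 isT (i + n.+1) (j + n.+1).
  by lia.
have Oin : Omega (i + n.+1) = lx.
  by move: last; rewrite !xcount1; case: (Omega (i + _)).
have Ojn : Omega (j + n.+1) = ly.
  by move: last; rewrite !xcount1; case: (Omega (j + _)); case: (Omega (i + _)).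
(* With P and Q the prefix and suffix of w of length k, balance of [x P] against [Q y] and of [Q x]
   against [y P] gives the two inequalities. *)
have PQ k : k <= n -> xcount (j + 1) k = xcount (j + (n.+1 - k)) k.
  move=> kn.
  have := bal k.+1 _ i (j + (n.+1 - k)); have := bal k.+1 _ (i + (n.+1 - k)) j.
  have P : xcount (i + 1) k = xcount (j + 1) k.
    have := step (1 + k); rewrite !xcountD; lia.
  have Q : xcount (i + (n.+1 - k)) k = xcount (j + (n.+1 - k)) k.
    have := step (n.+1 - k); have := step (n.+1 - k + k); rewrite !xcountD; lia.
  have l1 r : xcount r k.+1 = xcount r 1 + xcount (r + 1) k by rewrite -xcountD.
  have l2 r : xcount r k.+1 = xcount r k + xcount (r + k) 1.
    by rewrite -xcountD addn1.
  rewrite (l1 i) (l1 j) !(l2 (_ + _)).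
  rewrite (_ : i + (n.+1 - k) + k = i + n.+1); last by lia.
  rewrite (_ : j + (n.+1 - k) + k = j + n.+1); last by lia.
  by rewrite last P Q !xcount1 Oi Oj Ojn /=; lia.
have pal k : 0 < k <= n -> Omega (j + k) = Omega (j + (n.+1 - k)).
  move=> kn; apply: xcount1_inj.
  have := PQ k; have := PQ k.-1.
  rewrite (_ : n.+1 - k.-1 = (n.+1 - k) + 1); last by lia.
  have l1 r : xcount r k = xcount r 1 + xcount (r + 1) k.-1.
    by rewrite -xcountD; congr xcount; lia.
  have l2 r : xcount r k = xcount r k.-1 + xcount (r + k.-1) 1.
    by rewrite -xcountD; congr xcount; lia.
  rewrite (l1 (j + (_ - _))) l2 (_ : j + 1 + k.-1 = j + k); last by lia.
  by rewrite addnA; lia.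
have /eqP/cards1P [z zE] := card_right_special (ltn0Sn n).
have : z \in right_special n.+1 by rewrite zE inE.
case/tupleP: z zE => l z zE.
rewrite inE => /andP[/asboolP zx /asboolP zy].
have z_special : z \in right_special n.
  rewrite inE; apply/andP; split; apply/asboolP.
    exact: (@subword_catr _ [:: l]).
  exact: (@subword_catr _ [:: l]).
have w_special : block_tuple i.+1 n \in right_special n.
  rewrite inE; apply/andP; split; apply/asboolP => /=.
    by rewrite -Oin addnS -addSn -block_rcons; apply: subword_block.
  have -> : block i.+1 n = block j.+1 n.
    by apply/eq_blockP => k kn; rewrite !addSnnS Oij.
  by rewrite -Ojn addnS -addSn -block_rcons; apply: subword_block.
(* Both are right special of length n; uniqueness needs 0 < n, and for n = 0 both are empty. *)
have zw : z = block_tuple i.+1 n.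
  case: n z w_special z_special
    {bal step unbal m2 Oij last Oin Ojn PQ pal zE zx zy} => [|n] z ws zs;
    first by rewrite [z]tuple0 [RHS]tuple0.
  have /eqP/cards1P [y yE] := card_right_special (ltn0Sn n).
  by move: ws zs; rewrite yE !inE => /eqP -> /eqP ->.
have Oji k : 0 < k <= n -> Omega (j + k) = Omega (i + k) by move/Oij.
case: l zE {zx zy} => zE.
  have := @right_special_neq_palindrome i j n lx ly isT Oi Oj Oij Ojn pal.
  move/eqP; apply; rewrite zE; congr (finset.set1 _); apply/val_inj => /=.
  by rewrite zw /= -Oi.
have pal' k : 0 < k <= n -> Omega (i + k) = Omega (i + (n.+1 - k)).
  move=> kn; have kn' : 0 < n.+1 - k <= n by clear -kn; lia.
  by rewrite (Oij _ kn) (Oij _ kn'); apply: pal.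
have := @right_special_neq_palindrome j i n ly lx isT Oj Oi Oji Oin pal'.
move/eqP; apply; rewrite zE; congr (finset.set1 _); apply/val_inj => /=.
rewrite zw -Oj /=; congr (_ :: _).
by apply/eq_blockP => k kn; rewrite !addSnnS Oij.
Qed.

End Combinatorics.

(** Beyond a nonzero term, the partial sums of the tail are bounded by B - 1. *)
Lemma bounded_sum_eventually0 (f : nat -> nat) B :
  (forall n, \sum_(i < n) f i <= B) -> exists m, forall i, m <= i -> f i = 0.
Proof.
elim: B f => [|B IH] f fB.
  by exists 0 => i _; have := fB i.+1; rewrite big_ord_recr /=; lia.
have [[i fi]|nf] := pselect (exists i, 0 < f i); last first.
  by exists 0 => i _; apply: contrapT => fi; apply: nf; exists i; lia.
have [|m Hm] := IH (fun k => f (i.+1 + k)).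
  move=> n; have := fB (i.+1 + n).
  by rewrite big_split_ord big_ord_recr /=; lia.
exists (i.+1 + m) => j le_j; rewrite -(Hm (j - i.+1)); last by lia.
by congr f; lia.
Qed.

(** * The slope, and the degree on factors *)

Section Slope.
Local Open Scope ring_scope.
Local Open Scope classical_set_scope.
Variables (R : realType) (Omega : nat -> letter).
Hypothesis sturm : sturmian Omega.
Local Notation xcount := (xcount Omega).
Local Notation slope := (slope Omega R).

Lemma xcount_mul i j k n :
  (xcount i (k * n) <= k * xcount j n + k /\
   k * xcount j n <= xcount i (k * n) + k)%N.
Proof.
elim: k i => [|k IH] i; first by rewrite !mul0n.
have := sturmian_balanced sturm i j n; have := sturmian_balanced sturm j i n.
by have := IH (i + n)%N; rewrite !mulSn xcountD; lia.
Qed.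

(** Both blocks are compared with one block of length (m + 1)(n + 1), cut into pieces of either
    length. *)
Lemma xcount_ratio i j m n :
  ((xcount i m.+1)%:R - 1) / m.+1%:R <= ((xcount j n.+1)%:R + 1) / n.+1%:R :> R.
Proof.
rewrite ler_pdivrMr // mulrAC ler_pdivlMr // mulrBl mulrDl !mul1r.
rewrite lerBlDr -!natrM -!natrD ler_nat.
have [_] := xcount_mul 0 i n.+1 m.+1; have [+ _] := xcount_mul 0 j m.+1 n.+1.
by rewrite (mulnC m.+1 n.+1); lia.
Qed.

(** By [xcount_ratio] the supremum of all lower estimates is below every upper one; prefix
    frequencies are within 1/n of it, hence it is the slope. *)
Lemma xcount_slope i n : `|(xcount i n)%:R - n%:R * slope| <= 1.
Proof.
pose E : set R :=
  range (fun p => ((xcount p.1 p.2.+1)%:R - 1) / p.2.+1%:R).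
have Eb j m : ubound E (((xcount j m.+1)%:R + 1) / m.+1%:R).
  by move=> _ [p _ <-]; apply: xcount_ratio.
have E0 : E !=set0 by exists (((xcount 0 1)%:R - 1) / 1); exists (0, 0)%N.
have bound j m : `|(xcount j m.+1)%:R - m.+1%:R * sup E| <= 1.
  have hi : ((xcount j m.+1)%:R - 1) / m.+1%:R <= sup E.
    apply: ub_le_sup; last by exists (j, m).
    by exists (((xcount 0 1)%:R + 1) / 1); apply: Eb.
  have lo := ge_sup E0 (@Eb j m).
  move: hi lo; rewrite ler_pdivrMr // ler_pdivlMr // => hi lo.
  by rewrite ler_norml; apply/andP; split; lra.
suff -> : slope = sup E.
  by case: n => [|n] //; rewrite mul0r subr0 normr0 ler01.
apply: cvg_lim => //.
apply: (@squeeze_cvgr _ _ _ _ (fun n => sup E - harmonic n)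
  (fun n => sup E + harmonic n)).
- near=> k; rewrite /frequency /occ.
  have -> : size (val (initial Omega k)) = k.+1 by apply: size_block.
  have := bound 0%N k; rewrite ler_norml => /andP[lo hi].
  rewrite -[count_mem lx (val (initial Omega k))]/(xcount 0 k.+1) /harmonic /=.
  rewrite ler_pdivlMr // ler_pdivrMr // mulrBl mulrDl mulVf ?pnatr_eq0 //.
  by apply/andP; split; lra.
- by rewrite -[X in _ --> X]subr0; apply: cvgB;
    [apply: cvg_cst|apply: cvg_harmonic].
- by rewrite -[X in _ --> X]addr0; apply: cvgD;
    [apply: cvg_cst|apply: cvg_harmonic].
Unshelve. all: by end_near.
Qed.

Lemma degreeE (w : word) :
  degree Omega R w = (count_mem lx (val w))%:R - (size (val w))%:R * slope.
Proof.
have <- : (count_mem lx (val w) + count_mem ly (val w) = size (val w))%N.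
  by elim: (val w) => //= -[] s /= <-; lia.
by rewrite /degree /occ natrD; lra.
Qed.

Lemma degreeM (u v : word) :
  degree Omega R (u * v)%g = degree Omega R u + degree Omega R v.
Proof. by rewrite !degreeE /= count_cat size_cat !natrD; lra. Qed.

Lemma degree_bounded (w : word) :
  subword Omega (val w) -> `|degree Omega R w| <= 1.
Proof.
by case=> i wE; rewrite degreeE {1}wE; apply: xcount_slope.
Qed.

Lemma xcount_sum i n : xcount i n = (\sum_(k < n) xcount (i + k) 1)%N.
Proof.
by elim: n => [|n IH]; rewrite ?big_ord0 // big_ord_recr /= -IH -xcountD addn1.
Qed.

(* If [w] has [q] letters, [p] of them x, and degree 0, then the slope is     *)
(* [p / q]; by balance the counts of x in the blocks of length [q] are all at *)
(* most [p] or all at least [p], and their total deviation from [p] is        *)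
(* bounded, so they are eventually equal to [p].                              *)
Lemma degree_neq0 (w : word) : subword Omega (val w) -> degree Omega R w != 0.
Proof.
case=> i wE; rewrite degreeE {1}wE; apply/eqP => /eqP; rewrite subr_eq0 => /eqP.
have : (0 < size (val w))%N by rewrite lt0n size_eq0; apply: (valP w).
move: (size _) => q {wE} q0; rewrite -[count_mem _ _]/(xcount i q).
set p := xcount i q => pE.
have sumc N : (\sum_(r < N) xcount r q = \sum_(k < q) xcount k N)%N.
  transitivity (\sum_(r < N) \sum_(k < q) xcount (r + k) 1)%N.
    by apply: eq_bigr => r _; rewrite xcount_sum.
  rewrite exchange_big; apply: eq_bigr => k _; rewrite xcount_sum.
  by apply: eq_bigr => r _; rewrite addnC.
(* After the exchange of sums there are q blocks of length N, each within 1 of N times the slope. *)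
have dev N : (\sum_(r < N) xcount r q <= N * p + q /\
              N * p <= \sum_(r < N) xcount r q + q)%N.
  have : `|(\sum_(k < q) xcount k N)%:R - (N * p)%:R| <= q%:R :> R.
    rewrite natrM pE natr_sum.
    have -> : N%:R * (q%:R * slope) = \sum_(k < q) (N%:R * slope).
      by rewrite sumr_const card_ord -[RHS]mulr_natl; lra.
    rewrite -sumrB; apply: le_trans (ler_norm_sum _ _ _) _.
    have -> : q%:R = \sum_(k < q) 1 :> R by rewrite sumr_const card_ord.
    by apply: ler_sum => k _; apply: xcount_slope.
  by rewrite sumc ler_norml lerBlDl lerBrDl -!natrD lerBlDr -natrD !ler_nat;
    lia.
(* If sliding the window keeps its count, the letter entering equals the letter leaving, so q is an
   eventual period. *)
suff [M cM] : exists M, forall r, (M <= r)%N -> xcount r q = p.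
  apply: (sturmian_aperiodic sturm q0 (N := M)) => r Mr.
  apply/esym/xcount1_inj; have := xcountD Omega r 1 q;
    have := xcountD Omega r q 1.
  by rewrite addn1 add1n addn1 !cM // ?leqW //; lia.
have [[r0 lt_r0]|ge_p] := pselect (exists r, xcount r q < p)%N.
  have le_p r : (xcount r q <= p)%N.
    by have := sturmian_balanced sturm r r0 q; lia.
  have [|M HM] := @bounded_sum_eventually0 (fun r => p - xcount r q)%N q.
    move=> N; have [_] := dev N; rewrite -leq_subLR => h.
    apply: leq_trans h;
      rewrite -[X in (_ <= X * _ - _)%N]card_ord -sum_nat_const.
    by rewrite -sumnB.
  by exists M => r /HM; have := le_p r; lia.
have le_p r : (p <= xcount r q)%N.
  by rewrite leqNgt; apply/negP => h; apply: ge_p; exists r.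
have [|M HM] := @bounded_sum_eventually0 (fun r => xcount r q - p)%N q.
  move=> N; have [+ _] := dev N; rewrite -leq_subLR => h.
  apply: leq_trans h; rewrite -[X in (_ <= _ - X * _)%N]card_ord -sum_nat_const.
  by rewrite -sumnB.
by exists M => r /HM; have := le_p r; lia.
Qed.

End Slope.

(** * Subspaces spanned by subsets of the semigroup *)

Section ContractedSub.
Local Open Scope ring_scope.
Local Open Scope classical_set_scope.
Local Open Scope nualg_scope.
Variables (K : comNzRingType) (T : semigroup0Type).
Implicit Types (f g : contracted K T) (U V W : set T).

Lemma contracted_sub0 U : contracted_sub U (0 : contracted K T).
Proof. by move=> t; rewrite msupp0 inE. Qed.

Lemma contracted_subD U f g :
  contracted_sub U f -> contracted_sub U g -> contracted_sub U (f + g).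
Proof.
move=> Uf Ug t /(fsubsetP (msuppD_le f g)).
by rewrite in_fsetU => /orP[/Uf|/Ug].
Qed.

Lemma contracted_subZ U c f : contracted_sub U f -> contracted_sub U (c *: f).
Proof. by move=> Uf t /(fsubsetP (msuppZ_le c f)) /Uf. Qed.

Lemma contracted_sub_sum U (I : eqType) (r : seq I) (P : pred I)
    (F : I -> contracted K T) :
  (forall i, i \in r -> P i -> contracted_sub U (F i)) ->
  contracted_sub U (\sum_(i <- r | P i) F i).
Proof.
move=> UF; rewrite big_seq_cond; elim/big_ind: _.
- exact: contracted_sub0.
- by move=> f g; apply: contracted_subD.
- by move=> i /andP[]; apply: UF.
Qed.

Lemma contracted_sub_basis U t : U t -> contracted_sub U (cbasis K t).
Proof.
move=> Ut; rewrite /cbasis; case: insubP => [b _ bt|_] s; last first.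
  by rewrite msupp0 inE.
by move/(fsubsetP msuppU_le); rewrite inE => /eqP ->; rewrite bt.
Qed.

Lemma contracted_subM U V W f g :
  (forall s t, U s -> V t -> W (s * t)%g) ->
  contracted_sub U f -> contracted_sub V g -> contracted_sub W (f ** g).
Proof.
move=> UVW Uf Vg; apply: contracted_sub_sum => s sf _.
apply: contracted_sub_sum => t tg _.
apply: contracted_subZ; apply: contracted_sub_basis.
by apply: UVW; [apply: Uf|apply: Vg].
Qed.

Lemma subalgebra_contracted_sub U :
  (forall s t, U s -> U t -> U (s * t)%g) ->
  subalgebra (contracted_sub U : set (contracted K T)).
Proof.
move=> UM; split.
- exact: contracted_sub0.
- by move=> f g; apply: contracted_subD.
- by move=> c f; apply: contracted_subZ.
- by move=> f g; apply: contracted_subM.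
Qed.

End ContractedSub.

(** * Bounded degree implies local nilpotency *)

Lemma seq_lower_bound (R : realDomainType) (s : seq R) :
  (forall x, x \in s -> 0 < x)%R ->
  (exists2 e, 0 < e & forall x, x \in s -> e <= x)%R.
Proof.
elim: s => [|y s IH] s0; first by exists 1%R.
have [x xs|e e0 es] := IH; first by apply: s0; rewrite inE xs orbT.
exists (Num.min y e); first by rewrite lt_min e0 s0 ?mem_head.
by move=> x; rewrite inE ge_min => /orP[/eqP ->|/es ->]; rewrite ?lexx ?orbT.
Qed.

Section BoundedDegree.
Local Open Scope ring_scope.
Local Open Scope classical_set_scope.
Local Open Scope nualg_scope.
Variables (R : realType) (K : comNzRingType) (S : semigroupType) (I : ideal S).
Variables (d : S -> R) (B : R).
Hypothesis dM : forall s t, d (s * t)%g = d s + d t.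
Hypothesis dB : forall s, ~~ I s -> d s <= B.

(** A filtration: the zero class lies in every level, and is alone once e > B. *)
Definition degree_ge (e : R) : set (rees I) :=
  [set a | if a is Some s then e <= d (val s) else True].

Definition degree_pos : set (rees I) :=
  [set a | if a is Some s then 0 < d (val s) else True].

Lemma degree_geM e e' a b :
  degree_ge e a -> degree_ge e' b -> degree_ge (e + e') (a * b)%g.
Proof.
case: a b => [s|] [t|] // es et; rewrite /= /rees_class.
rewrite -[(_ * _)%g]/(rees_class I (val s * val t)%g) /rees_class.
case: insubP => // u _ uE.
by rewrite /degree_ge /= uE dM lerD.
Qed.

Lemma degree_posM a b : degree_pos a -> degree_pos b -> degree_pos (a * b)%g.
Proof.
case: a b => [s|] [t|] // es et.
rewrite -[(_ * _)%g]/(rees_class I (val s * val t)%g) /rees_class.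
case: insubP => // u _ uE.
by rewrite /degree_pos /= uE dM addr_gt0.
Qed.

Lemma contracted_degree_ge_eq0 e (f : contracted K (rees I)) :
  B < e -> contracted_sub (degree_ge e) f -> f = 0.
Proof.
move=> Be fe; apply/malgP => t; rewrite mcoeff0; apply: mcoeff_outdom.
apply/negP => /fe; case: t => -[[s sI]|] t0 //=.
by apply/negP; rewrite -ltNge (le_lt_trans (dB sI)).
Qed.

(* A product of [n.+1] elements supported in degrees at least [e > 0] is      *)
(* supported in degrees at least [n.+1 * e], which exceeds [B] for large [n]. *)
Lemma degree_pos_locally_nilpotent :
  locally_nilpotent (contracted_sub degree_pos : set (contracted K (rees I))).
Proof.
move=> s s_pos.
(* The 1 is a positive placeholder for the zero class, which no t represents. *)
pose deg (t : nonzero (rees I)) : R := if val t is Some u then d (val u) else 1.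
have [x|e e0 es] := @seq_lower_bound R [seq deg t | f <- s, t <- msupp f].
  case/allpairsPdep => f [t [fs tf ->]].
  by have := s_pos f fs t tf; rewrite /deg /degree_pos /=; case: (val t).
have gen f : generated_subalgebra [set` s] f -> contracted_sub (degree_ge e) f.
  apply: smallest_sub.
    apply: subalgebra_contracted_sub => a b ea eb.
    have := degree_geM ea eb; case: (a * b)%g => //= u.
    by apply: le_trans; rewrite lerDl ltW.
  move=> {}f fs t tf.
  have : e <= deg t by apply: es; apply/allpairsPdep; exists f, t.
  by rewrite /deg /degree_ge /=; case: (val t).
have prod f r c : contracted_sub (degree_ge c) f ->
    [set` r] `<=` generated_subalgebra [set` s] ->
    contracted_sub (degree_ge (c + (size r)%:R * e)) (foldl numul f r).
  elim: r f c => [|g r IH] f c cf rs /=; first by rewrite mul0r addr0.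
  have -> : c + (size r).+1%:R * e = (c + e) + (size r)%:R * e.
    by rewrite -natr1; lra.
  apply: IH; last by move=> h hr; apply: rs; rewrite /= inE hr orbT.
  apply: contracted_subM cf _; first exact: degree_geM.
  by apply: gen; apply: rs; rewrite /= inE eqxx.
(* This n exceeds B / e, so e + n e > B. *)
exists (Num.bound `|B / e|) => f r fs rs rn.
apply: contracted_degree_ge_eq0 (prod f r e (gen f fs) rs).
rewrite rn -ltrBlDl; apply: (@lt_trans _ _ B); first by lra.
rewrite -ltr_pdivrMr //; apply: le_lt_trans (ler_norm _) _.
by apply: archi_boundP; apply: normr_ge0.
Qed.

End BoundedDegree.

(** * Powers of x + y *)

Section WordsOfLength.

Definition letter_word (l : letter) : word := exist _ [:: l] isT.

Definition letter_words : seq word := [:: letter_word lx; letter_word ly].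

(* The words of length [n.+1]. *)
Definition words n : seq word :=
  iter n (fun s => [seq (u * v)%g | u <- letter_words, v <- s]) letter_words.

Lemma wordsS n : words n.+1 = [seq (u * v)%g | u <- letter_words, v <- words n].
Proof. by []. Qed.

Lemma mem_words n (w : word) : size (val w) = n.+1 -> w \in words n.
Proof.
elim: n w => [|n IH] [[|l s] ws] // [sz].
  have -> : exist _ (l :: s) ws = letter_word l.
    by apply/val_inj; rewrite /= (size0nil sz).
  by case: l {ws}; rewrite !inE eqxx ?orbT.
have s0 : s != [::] by rewrite -size_eq0 sz.
rewrite wordsS; apply/allpairsP.
exists (letter_word l, exist _ s s0); split=> /=.
- by case: l {ws}; rewrite !inE eqxx ?orbT.
- exact: IH.
- exact/val_inj.
Qed.

Lemma words_uniq n : uniq (words n).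
Proof.
elim: n => [|n IH] //; rewrite wordsS; apply: allpairs_uniq => //.
have letterP u : u \in letter_words -> exists l, u = letter_word l.
  by rewrite !inE => /orP[] /eqP ->; eexists.
move=> _ _ /allpairsPdep[u [v [uP _ ->]]] /allpairsPdep[u' [v' [u'P _ ->]]] /=.
have [l ->] := letterP _ uP; have [l' ->] := letterP _ u'P.
by move=> /(congr1 val) /= [-> /val_inj ->].
Qed.

End WordsOfLength.

Section NotNil.
Local Open Scope ring_scope.
Local Open Scope nualg_scope.
Variables (K : fieldType) (Omega : nat -> letter).
Local Notation A := (contracted K (subword_semigroup Omega)).

(** Being 0 on non-factors, it is multiplicative on all words, so powers of x + y expand over
    [words]. *)
Definition word_basis (w : word) : A :=
  cbasis K (rees_class (non_subword_ideal Omega) w : subword_semigroup Omega).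

Definition letter_sum : A := \sum_(u <- letter_words) word_basis u.

Lemma word_basisM u v : word_basis u ** word_basis v = word_basis (u * v)%g.
Proof.
rewrite -[LHS]/(cmul (word_basis u) (word_basis v)) cmul_basis.
by congr cbasis; apply: rees_class_mul.
Qed.

Lemma letter_sum_exp n :
  iter n (numul letter_sum) letter_sum = \sum_(w <- words n) word_basis w.
Proof.
elim: n => [|n IH] //; rewrite wordsS iterS IH big_allpairs_dep /letter_sum.
rewrite -[LHS]/(cmul _ _) cmul_suml; apply: eq_bigr => u _.
by rewrite cmul_sumr; apply: eq_bigr => v _; apply: word_basisM.
Qed.

(** The initial factor of length n + 1 occurs once in [words n], so its coefficient in the power is
    1. *)
Lemma not_nil_contracted : ~ nil_algebra A.
Proof.
move=> /(_ letter_sum) [n]; rewrite letter_sum_exp => sum0.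
have initN : ~~ non_subword_ideal Omega (initial Omega n).
  by apply/asboolPn; apply; apply: (subword_block Omega 0 n.+1).
pose t : nonzero (subword_semigroup Omega) :=
  exist _ (Some (exist _ (initial Omega n) initN)) isT.
have coef w : (word_basis w)@_t = (w == initial Omega n)%:R.
  rewrite /word_basis /cbasis; case: insubP => [b _ bE|].
    rewrite mcoeffU -val_eqE bE /= /rees_class; case: insubP => [c _ <-|wI] //.
    by case: (w =P initial Omega n) wI => [->|//]; rewrite initN.
  rewrite mcoeff0 negbK /rees_class; case: insubP => // wI _.
  by case: (w =P initial Omega n) wI => [->|//]; rewrite initN.
have : (\sum_(w <- words n) word_basis w)@_t = 0 by rewrite sum0 mcoeff0.
rewrite raddf_sum /= (bigD1_seq (initial Omega n)) ?words_uniq //=; last first.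
  exact/mem_words/(size_block Omega 0 n.+1).
rewrite coef eqxx big1 ?addr0 => [/eqP|w /negbTE wn]; last by rewrite coef wn.
by rewrite oner_eq0.
Qed.

End NotNil.

(** * Splitting by the sign of the degree *)

Local Open Scope classical_set_scope.
Local Open Scope ring_scope.

Theorem theorem6 (R : realType) (K : fieldType) (Omega : nat -> letter)
    (hOmega : sturmian Omega) :
  let A := contracted K (subword_semigroup Omega) in
  let Aplus : set A := contracted_sub (positive_part Omega R) in
  let Aminus : set A := contracted_sub (negative_part Omega R) in
  [/\ ~ nil_algebra A,
      subalgebra Aplus /\ locally_nilpotent Aplus,
      subalgebra Aminus /\ locally_nilpotent Aminus &
      [set a + b | a in Aplus & b in Aminus] = [set: A]].
Proof.
move=> A Aplus Aminus.
pose I := non_subword_ideal Omega.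
have subI s : ~~ I s -> subword Omega (val s).
  by move=> /asboolPn; apply: contrapT.
have dM := @degreeM R Omega.
have dNM s t :
    - degree Omega R (s * t)%g = - degree Omega R s - degree Omega R t.
  by rewrite dM opprD.
have dB s : ~~ I s -> degree Omega R s <= 1.
  by move/subI => /(degree_bounded R hOmega); rewrite ler_norml => /andP[].
have dNB s : ~~ I s -> - degree Omega R s <= 1.
  by move/subI => /(degree_bounded R hOmega);
    rewrite ler_norml lerNl => /andP[].
have negE :
    negative_part Omega R = degree_pos (I := I) (fun s => - degree Omega R s).
  by apply/seteqP; split=> -[s|] //=; rewrite oppr_gt0.
split.
- exact: not_nil_contracted.
- split; first by apply: subalgebra_contracted_sub; apply: degree_posM dM.
  exact: degree_pos_locally_nilpotent dM dB.
- rewrite /Aminus negE; split.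
    by apply: subalgebra_contracted_sub; apply: degree_posM dNM.
  exact: degree_pos_locally_nilpotent dNM dNB.
apply/seteqP; split=> // f _.
pose pos (t : nonzero (subword_semigroup Omega)) :=
  if val t is Some u then 0 < degree Omega R (val u) else true.
rewrite [f]cbasis_sum (bigID pos) /=.
have [F G] : Aplus (\sum_(t <- msupp f | pos t) f@_t *: cbasis K (val t)) /\
    Aminus (\sum_(t <- msupp f | ~~ pos t) f@_t *: cbasis K (val t)).
  split; apply: contracted_sub_sum => t _ pt; apply: contracted_subZ;
    apply: contracted_sub_basis; move: pt; rewrite /pos; case: (val t) => //= u.
  (* A degree that is not positive is negative, since it cannot vanish on a factor. *)
  by rewrite -leNgt lt_neqAle => ->;
    rewrite (degree_neq0 R hOmega) //; exact: subI (valP u).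
by exists (\sum_(t <- msupp f | pos t) f@_t *: cbasis K (val t)) => //;
  exists (\sum_(t <- msupp f | ~~ pos t) f@_t *: cbasis K (val t)).
Qed.
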